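(* Let $A$ be a $2\times 2$ GUE matrix, and suppose that Gaussian elimination with partial pivoting compares pivot candidates using the $L^1$ norm $\|x+iy\|_1 = |x|+|y|$ ($x,y\in\mathbb{R}$). Then the pivot probability (the probability that a row swap is performed) is $$\mathbb{P}\left(\|A_{21}\|_1 > |A_{11}|\right) = \mathbb{P}\left(|Z_1|+|Z_2| > \sqrt{2}\,|Z_3|\right) = \frac{2}{3},$$ where $Z_1,Z_2,Z_3$ are independent and identically distributed standard normal $N(0,1)$ random variables.
   Context: A $2\times 2$ GUE (Gaussian unitary ensemble) matrix is $A = \frac{1}{\sqrt{2}}(G+G^* )$, where $G$ is a $2\times 2$ matrix with independent and identically distributed standard complex normal entries $N_{\mathbb{C}}(0,1)$, and $G^*$ is the conjugate transpose. Here $N_{\mathbb{C}}(0,1)$ is the law of $(X+iY)/\sqrt{2}$ with $X,Y$ independent real $N(0,1)$ variables. In particular $A_{11}\sim N(0,1)$ is real and $A_{21}\sim N_{\mathbb{C}}(0,1)$. For a $2\times 2$ matrix, Gaussian elimination with partial pivoting swaps the two rows exactly when the entry $A_{21}$ is strictly larger than $A_{11}$ in the chosen measure of magnitude. Here this measure is $\|x+iy\|_1=|x|+|y|$, which on real numbers is the usual absolute value. The pivot probability is the probability of this event. *)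

(* Defs.v *)
(* MathComp / MathComp-Analysis *)
From HB Require Import structures.
From mathcomp Require Import all_boot all_order all_algebra.
From mathcomp Require Import complex.
From mathcomp Require Import all_classical all_reals all_analysis.
From mathcomp Require Import measurable_realfun.

Set Implicit Arguments.
Unset Strict Implicit.
Unset Printing Implicit Defensive.

Import Order.TTheory GRing.Theory Num.Theory.
Import numFieldNormedType.Exports.

Local Open Scope classical_set_scope.
Local Open Scope ring_scope.

(* R[i] carries the Borel sigma-algebra of R * R, transported along
   z |-> (Re z, Im z). *)
Section complex_measurable.
Variable R : realType.

HB.instance Definition _ := isPointed.Build R[i] 0.

Let complex_measurable : set (set R[i]) :=
  g_sigma_preimageU (@complex.Re R) (@complex.Im R).

Let complex_measurable0 : complex_measurable set0.
Proof. exact: sigma_algebra0. Qed.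

Let complex_measurableC A :
  complex_measurable A -> complex_measurable (~` A).
Proof. exact: sigma_algebraC. Qed.

Let complex_measurable_bigcup (F : (set R[i])^nat) :
  (forall i, complex_measurable (F i)) -> complex_measurable (\bigcup_i (F i)).
Proof. exact: sigma_algebra_bigcup. Qed.

HB.instance Definition _ :=
  @isMeasurable.Build default_measure_display R[i] complex_measurable
    complex_measurable0 complex_measurableC complex_measurable_bigcup.

Lemma measurable_Re : measurable_fun setT (@complex.Re R).
Proof.
by move=> _ B mB; rewrite setTI; apply: sub_sigma_algebra; left; exists B;
  rewrite ?setTI.
Qed.

Lemma measurable_Im : measurable_fun setT (@complex.Im R).
Proof.
by move=> _ B mB; rewrite setTI; apply: sub_sigma_algebra; right; exists B;
  rewrite ?setTI.
Qed.

Lemma measurable_Complex d (T : measurableType d) (f g : T -> R) :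
  measurable_fun setT f -> measurable_fun setT g ->
  measurable_fun setT (fun t => Complex (f t) (g t)).
Proof.
move=> mf mg; apply: measurability => // _ [_ [[B mB <-]|[B mB <-]] <-].
- by rewrite !setTI -comp_preimage -[X in measurable X]setTI; exact: mf.
- by rewrite !setTI -comp_preimage -[X in measurable X]setTI; exact: mg.
Qed.

End complex_measurable.

Section random_variables.
Context d (T : measurableType d) (R : realType) (P : probability T R).
Context d' (T' : measurableType d').

(* Equality of laws is only required on measurable sets: the values of a
   measure elsewhere carry no meaning. *)
Definition has_law (X : {RV P >-> T'}) (mu : set T' -> \bar R) :=
  forall B : set T', measurable B -> distribution P X B = mu B.

Definition mutually_independent (I : finType) (X : I -> {RV P >-> T'}) :=
  forall (J : {set I}) (B : I -> set T'),
    (forall i, i \in J -> measurable (B i)) ->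
    P (\bigcap_(i in [set` J]) (X i @^-1` B i)) =
    (\prod_(i in J) P (X i @^-1` B i))%E.

Definition iid (I : finType) (X : I -> {RV P >-> T'})
    (mu : set T' -> \bar R) :=
  mutually_independent X /\ forall i, has_law (X i) mu.

End random_variables.

Section complex_normal.
Variable R : realType.

Definition std_normal : probability (measurableTypeR R) R := normal_prob 0 1.

Definition std_complex (p : measurableTypeR R * measurableTypeR R) : R[i] :=
  Complex (p.1 : R) (p.2 : R) / real_complex R (Num.sqrt 2).

Lemma measurable_std_complex : measurable_fun setT std_complex.
Proof.
have -> : std_complex = fun p =>
    Complex ((p.1 : R) * (Num.sqrt 2)^-1) ((p.2 : R) * (Num.sqrt 2)^-1).
  apply/funext => -[x y]; rewrite /std_complex -fmorphV /=.
  by congr Complex; rewrite /= mulr0 (subr0, add0r).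
by apply: measurable_Complex; apply: measurable_funM.
Qed.

HB.instance Definition _ :=
  isMeasurableFun.Build _ _ _ _ std_complex measurable_std_complex.

(* The law of (X + iY) / sqrt 2 for (X, Y) distributed as the product of two
   standard normal laws. *)
Definition std_complex_normal : probability R[i] R :=
  distribution (std_normal \x std_normal)%E std_complex.

End complex_normal.

Section pivoting.
Variable R : realType.

Definition l1norm (z : R[i]) : R := `|complex.Re z| + `|complex.Im z|.

(* Row 0 is the first row, as usual in MathComp, so A 0 0 and A 1 0 are the
   entries in positions (1,1) and (2,1). *)
Definition row_swap (mag : R[i] -> R) (A : 'M[R[i]]_2) : bool :=
  mag (A 1 0) > mag (A 0 0).

Definition conj_transpose (A : 'M[R[i]]_2) : 'M[R[i]]_2 :=
  map_mx (@conjc R) A^T.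

Context d (T : measurableType d) (P : probability T R).

Definition is_GUE2 (A : T -> 'M[R[i]]_2) :=
  exists G : 'I_2 * 'I_2 -> {RV P >-> R[i]},
    iid G (std_complex_normal R) /\
    forall t, let M := \matrix_(i < 2, j < 2) G (i, j) t in
      A t = (real_complex R (Num.sqrt 2))^-1 *: (M + conj_transpose M).

Definition pivot_probability (mag : R[i] -> R) (A : T -> 'M[R[i]]_2) : \bar R :=
  P [set t | row_swap mag (A t)].

End pivoting.

(* Main.v *)
Require Import Defs.
From HB Require Import structures.
From mathcomp Require Import all_boot all_order all_algebra.
From mathcomp Require Import complex.
From mathcomp Require Import all_classical all_reals all_analysis.
From mathcomp Require Import measurable_realfun.
From mathcomp Require Import ring lra.

Set Implicit Arguments.
Unset Strict Implicit.
Unset Printing Implicit Defensive.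

Import Order.TTheory GRing.Theory Num.Theory.
Import numFieldNormedType.Exports.

Local Open Scope classical_set_scope.
Local Open Scope ring_scope.

(** Two facts about standard normal variables carry the proof.

    The first is that a pair [(X, Y)] of independent standard normal variables
    has the same law as [((X - Y) / sqrt 2, (X + Y) / sqrt 2)]
    ([std_normal2_rot45]): Lebesgue measure on the plane and the radial density
    are both invariant under a rotation by 45 degrees.  It is used twice.

    On the matrix side, [A_11 = sqrt 2 Re G_11] and
    [A_21 = (G_21 + conj G_12) / sqrt 2].  Since a standard complex normal
    entry is [(X + iY) / sqrt 2], the variables [Re G_21 + Re G_12] and
    [Im G_21 - Im G_12] have the form [(X + X') / sqrt 2] and
    [(Y - Y') / sqrt 2]: by rotation they are again standard normal, and they
    are independent of each other and of [sqrt 2 Re G_11], which is standard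
    normal too ([measure_GUE2_pivot]).  Multiplying by [sqrt 2], the row swap
    becomes the event [sqrt 2 |Z_3| < |Z_1| + |Z_2|].

    On the numerical side, [|x| + |y|] is the larger of [|x - y|] and
    [|x + y|], that is, [sqrt 2] times the larger absolute coordinate of the
    rotated point ([addr_norm_rot45]).  Rotating [(Z_1, Z_2)] therefore turns
    the event into [|Z_3| < max (|Z_1|, |Z_2|)].

    The second fact is exchangeability: ties have probability zero, so each of
    [|Z_1|, |Z_2|, |Z_3|] is the largest with probability [1/3], and the third
    one fails to be the largest with probability [2/3]
    ([iid_normal_lt_max]). *)

(** * Joint laws and product measures *)

Section law_of_pairs.
Local Open Scope ereal_scope.
Context d (T : measurableType d) (R : realType).
Context d1 (T1 : measurableType d1) d2 (T2 : measurableType d2).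

(** Independence is only given on rectangles; they form a pi-system generating
    the product sigma-algebra, so they determine the joint law. *)
Lemma joint_law2 (P : {measure set T -> \bar R})
    (n1 : {sigma_finite_measure set T1 -> \bar R})
    (n2 : {sigma_finite_measure set T2 -> \bar R}) (X : T -> T1) (Y : T -> T2) :
  measurable_fun setT X -> measurable_fun setT Y ->
  (forall A B, measurable A -> measurable B ->
    P (X @^-1` A `&` Y @^-1` B) = n1 A * n2 B) ->
  forall S, measurable S -> P [set t | S (X t, Y t)] = (n1 \x n2) S.
Proof.
move=> mX mY XY S mS.
have mXY : measurable_fun setT (fun t => (X t, Y t)).
  exact: measurable_fun_pair.
pose mix := isMeasurableFun.Build _ _ _ _ _ mXY.
pose XY' : {mfun T >-> _} := HB.pack (fun t => (X t, Y t)) mix.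
by rewrite (@product_measure_unique _ _ _ _ _ n1 n2 (pushforward P XY')).
Qed.

End law_of_pairs.

Section law_of_triples.
Local Open Scope ereal_scope.
Context d (T : measurableType d) (R : realType).
Context d1 (T1 : measurableType d1) d2 (T2 : measurableType d2).
Context d3 (T3 : measurableType d3).

(** The pair [(X, Y)] must be tested against every measurable set of the plane
    before it can be paired with [Z].  For fixed [C], the measure [P] restricted
    to the event [Z \in C] is, as seen by [(X, Y)], the product measure scaled
    by [n3 C], so the case of pairs applies to it. *)
Lemma joint_law3 (P : probability T R) (n1 : probability T1 R)
    (n2 : probability T2 R) (n3 : probability T3 R)
    (X : T -> T1) (Y : T -> T2) (Z : T -> T3) :
  measurable_fun setT X -> measurable_fun setT Y -> measurable_fun setT Z ->
  (forall A B C, measurable A -> measurable B -> measurable C ->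
    P (X @^-1` A `&` Y @^-1` B `&` Z @^-1` C) = n1 A * n2 B * n3 C) ->
  forall S, measurable S ->
    P [set t | S ((X t, Y t), Z t)] = ((n1 \x n2) \x n3) S.
Proof.
move=> mX mY mZ XYZ S mS.
pose n12 : probability (T1 * T2)%type R := (n1 \x n2).
have -> // := @joint_law2 _ T R _ _ _ T3 P n12 n3 (fun t => (X t, Y t)) Z
  _ mZ _ S mS.
  exact: measurable_fun_pair.
move=> A C mA mC.
have mZC : measurable (Z @^-1` C) by rewrite -[_ @^-1` _]setTI; exact: mZ.
have n3C : n3 C = (fine (n3 C))%:E by rewrite fineK// fin_num_measure.
pose c : {nonneg R} := NngNum (fine_ge0 (measure_ge0 n3 C)).
transitivity (mrestr P mZC [set t | A (X t, Y t)]) => //.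
rewrite (@joint_law2 _ _ _ _ _ _ _ (mrestr P mZC) (mscale c n1) n2) //.
- rewrite /n12 /= /product_measure1 ge0_integral_mscale//= -?n3C 1?muleC//.
  exact: measurable_fun_xsection.
- move=> A1 A2 mA1 mA2.
  transitivity (n1 A1 * n2 A2 * n3 C); first by rewrite -XYZ.
  by rewrite n3C /mscale/= muleC muleA.
Qed.

End law_of_triples.

Section marginals.
Local Open Scope ereal_scope.
Context (R : realType) d1 (T1 : measurableType d1) d2 (T2 : measurableType d2).
Variables (n1 : probability T1 R) (n2 : probability T2 R).

Lemma product_measure_fst A : measurable A -> (n1 \x n2) [set z | A z.1] = n1 A.
Proof.
move=> mA; have -> : [set z : T1 * T2 | A z.1] = A `*` setT.
  by apply/seteqP; split => z //= [].
by rewrite product_measure1E// [X in _ * X](probability_setT n2) mule1.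
Qed.

Lemma product_measure_snd A : measurable A -> (n1 \x n2) [set z | A z.2] = n2 A.
Proof.
move=> mA; have -> : [set z : T1 * T2 | A z.2] = setT `*` A.
  by apply/seteqP; split => z //= [].
by rewrite product_measure1E// [X in X * _](probability_setT n1) mul1e.
Qed.

End marginals.

Section interchange.
Local Open Scope ereal_scope.
Context (R : realType) d1 (T1 : measurableType d1) d2 (T2 : measurableType d2).
Context d3 (T3 : measurableType d3) d4 (T4 : measurableType d4).
Variables (n1 : probability T1 R) (n2 : probability T2 R).
Variables (n3 : probability T3 R) (n4 : probability T4 R).

(** The section of the left-hand set at [p] is the rectangle
    [xsection E p.1 `*` xsection F p.2], whose measure factors; what remains is
    the integral of a product of functions of [p.1] and of [p.2]. *)
Lemma product_measure_interchange E F : measurable E -> measurable F ->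
  ((n1 \x n2) \x (n3 \x n4))
    [set w | E (w.1.1, w.2.1) /\ F (w.1.2, w.2.2)] =
  (n1 \x n3) E * (n2 \x n4) F.
Proof.
move=> mE mF.
pose a x := n3 (xsection E x); pose b y := n4 (xsection F y).
have ma : measurable_fun setT a by exact: measurable_fun_xsection.
have mb : measurable_fun setT b by exact: measurable_fun_xsection.
transitivity (\int[n1 \x n2]_p (a p.1 * b p.2)).
  apply: eq_integral => p _; rewrite /= -product_measure1E//; last 2 first.
  - exact: measurable_xsection.
  - exact: measurable_xsection.
  congr ((n3 \x n4) _); apply/seteqP.
  by split => q; rewrite /xsection/= !inE.
rewrite fubini_tonelli1/=; last 2 first.
- by apply: emeasurable_funM; exact: measurableT_comp.
- by move=> p; rewrite mule_ge0.
transitivity (\int[n1]_x (a x * (n2 \x n4) F)).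
  by apply: eq_integral => x _; rewrite /fubini_F/= ge0_integralZl.
by rewrite ge0_integralZr.
Qed.

End interchange.

Section iid_law.
Local Open Scope ereal_scope.
Context d (T : measurableType d) (R : realType) (P : probability T R).
Context d1 (T1 : measurableType d1) (mu : set T1 -> \bar R).
Context d2 (T2 : measurableType d2) (n : probability T2 R) (h : T1 -> T2).
Context (I : finType) (X : I -> {RV P >-> T1}).

(** The map [h] transports the common law to another measurable type.  It is
    needed even when it is the identity, since [R] and [measurableTypeR R] are
    distinct measurable types with the same measurable sets. *)
Lemma iid_law3 (i j k : I) S : iid X mu -> measurable_fun setT h ->
  (forall U, measurable U -> mu (h @^-1` U) = n U) ->
  uniq [:: i; j; k] -> measurable S ->
  P [set t | S ((h (X i t), h (X j t)), h (X k t))] = ((n \x n) \x n) S.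
Proof.
move=> [indX lawX] mh hn /= /and3P[]; rewrite !inE => /norP[ij ik] jk _ mS.
have mhV U : measurable U -> measurable (h @^-1` U).
  by move=> mU; rewrite -[X in measurable X]setTI; exact: mh.
have law l U : measurable U -> P (X l @^-1` (h @^-1` U)) = n U.
  by move=> mU; rewrite -hn//; exact/lawX/mhV.
have mX l : measurable_fun setT (h \o X l) by exact: measurableT_comp.
apply: (@joint_law3 _ T R _ T2 _ T2 _ T2 P n n n (h \o X i) (h \o X j)
  (h \o X k)) => // A B C mA mB mC.
pose D l := if l == i then A else if l == j then B else C.
have Di : D i = A by rewrite /D eqxx.
have Dj : D j = B by rewrite /D eqxx eq_sym (negbTE ij).
have Dk : D k = C by rewrite /D eq_sym (negbTE ik) eq_sym (negbTE jk).
have mD l : measurable (D l) by rewrite /D; case: ifP => // _; case: ifP.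
have mhD l : measurable (h @^-1` D l) by exact: mhV.
have := indX [set i; j; k]%SET (fun l => h @^-1` D l) (fun l _ => mhD l).
have -> : \bigcap_(l in [set` [set i; j; k]%SET]) (X l @^-1` (h @^-1` D l)) =
    (h \o X i) @^-1` A `&` (h \o X j) @^-1` B `&` (h \o X k) @^-1` C.
  apply/seteqP; split => t /=.
    move=> XD; split; first split.
    - by have /= := XD i; rewrite Di; apply; rewrite !inE eqxx.
    - by have /= := XD j; rewrite Dj; apply; rewrite !inE eqxx orbT.
    - by have /= := XD k; rewrite Dk; apply; rewrite !inE eqxx !orbT.
  move=> [[tA tB] tC] l /=; rewrite !inE => /orP[/orP[]|] /eqP ->;
  by rewrite ?Di ?Dj ?Dk.
move=> ->; rewrite finset.setUC big_setU1/=; last first.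
  by rewrite !inE negb_or eq_sym ik eq_sym jk.
rewrite big_setU1 ?inE// big_set1 Di Dj Dk !law//.
by rewrite muleC.
Qed.

End iid_law.

(** * Rotation invariance of the standard normal law *)

Section std_normal_law.
Local Open Scope ereal_scope.
Variable R : realType.
Local Notation mu := (@lebesgue_measure R).
Local Notation N := (std_normal R).

(** [std_normal] is defined by integrating its density, and Radon-Nikodym
    derivatives are unique almost everywhere, so the derivative provided by the
    change of measure formula is that density. *)
Lemma integral_std_normal (f : R -> \bar R) :
  measurable_fun [set: R] f -> (forall x, 0 <= f x) ->
  \int[N]_x f x = \int[mu]_x (f x * (normal_pdf 0 1 x)%:E).
Proof.
move=> mf f0.
have Nmu : N `<< mu := @normal_prob_dominates R 0 1.
rewrite -(Radon_Nikodym_SigmaFinite.change_of_variables Nmu f0 measurableT mf).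
have mg := measurable_int _ (Radon_Nikodym_SigmaFinite.f_integrable Nmu).
have mpdf : measurable_fun [set: R] (fun x => (normal_pdf 0 1 x : R)%:E).
  by apply/measurable_EFinP; exact: measurable_normal_pdf.
apply: ae_eq_integral => //.
- exact: emeasurable_funM.
- exact: emeasurable_funM.
- apply: ae_eqe_mul2l; apply: integral_ae_eq => //.
  + exact: Radon_Nikodym_SigmaFinite.f_integrable.
  + by move=> E _ mE; rewrite -(Radon_Nikodym_SigmaFinite.f_integral Nmu).
Qed.

(** Lebesgue measure is determined by its values on intervals, and the preimage
    of an interval under the affine map is [a] times shorter. *)
Lemma integral_affine (a b : R) (f : R -> \bar R) : (0 < a)%R ->
  measurable_fun [set: R] f -> (forall x, 0 <= f x) ->
  \int[mu]_x f x = a%:E * \int[mu]_x f (a * x + b)%R.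
Proof.
move=> a0 mf f0.
pose h : R -> measurableTypeR R := fun x => (a * x + b)%R.
have mh : measurable_fun [set: measurableTypeR R] h.
  by apply: measurable_funD => //; exact: measurable_funM.
pose mix := isMeasurableFun.Build _ _ _ _ _ mh.
pose h' : {mfun measurableTypeR R >-> measurableTypeR R} := HB.pack h mix.
pose c : {nonneg R} := NngNum (ltW a0).
have muE A : measurable A -> mu A = mscale c (pushforward mu h') A.
  move=> mA; apply: lebesgue_measure_unique => // _ [[p q]] _ <-.
  rewrite /mscale/= /pushforward/=.
  have hE : h @^-1` [set` `]p, q]%R] = [set` `](p - b) / a, (q - b) / a]%R].
    apply/seteqP; split => x /=; rewrite /h !in_itv/=;
    by rewrite ltr_pdivrMr// ler_pdivlMr// ltrBlDr lerBrDr [(x * a)%R]mulrC.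
  transitivity (a%:E * mu [set` `](p - b) / a, (q - b) / a]%R]); last by rewrite -hE.
  rewrite !lebesgue_measure_itv/= !lte_fin ltr_pM2r ?invr_gt0// ltrD2r.
  case: ifP => pq; last by rewrite mule0.
  rewrite -!EFinB -EFinM; congr EFin; field; exact: lt0r_neq0.
rewrite (eq_measure_integral (mscale c (pushforward mu h'))); last first.
  by move=> A mA _; exact: muE.
by rewrite ge0_integral_mscale//= ge0_integral_pushforward.
Qed.

Lemma integral_std_normal2 (f : measurableTypeR R * measurableTypeR R -> \bar R) :
  measurable_fun setT f -> (forall z, 0 <= f z) ->
  \int[N \x N]_z f z =
  \int[mu \x mu]_z (f z * (normal_pdf 0 1 z.1 * normal_pdf 0 1 z.2)%:E).
Proof.
move=> mf f0.
have mpdf : measurable_fun [set: measurableTypeR R] (normal_pdf (0 : R) 1).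
  exact: measurable_normal_pdf.
rewrite fubini_tonelli1// integral_std_normal; last 2 first.
- exact: measurable_fun_fubini_tonelli_F.
- by move=> x; exact: integral_ge0.
rewrite fubini_tonelli1/=; last 2 first.
- apply: emeasurable_funM => //; apply/measurable_EFinP.
  by apply: measurable_funM; exact: measurableT_comp.
- by move=> z; rewrite mule_ge0// lee_fin mulr_ge0// normal_pdf_ge0.
apply: eq_integral => x _; rewrite /fubini_F.
rewrite integral_std_normal//; last exact: measurable_fun_pair2.
rewrite -ge0_integralZr//.
- by apply: eq_integral => y _; rewrite -muleA -EFinM [(normal_pdf 0 1 y * _)%R]mulrC.
- apply: emeasurable_funM; last exact/measurable_EFinP.
  exact: measurable_fun_pair2.
- by move=> y _; rewrite mule_ge0// lee_fin normal_pdf_ge0.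
- by rewrite lee_fin normal_pdf_ge0.
Qed.

Definition rot45 (z : measurableTypeR R * measurableTypeR R) :
    measurableTypeR R * measurableTypeR R :=
  (((z.1 : R) - z.2) / Num.sqrt 2, ((z.1 : R) + z.2) / Num.sqrt 2)%R.

Lemma measurable_rot45 : measurable_fun setT rot45.
Proof.
apply: measurable_fun_pair; apply: measurable_funM => //.
  exact: measurable_funB.
exact: measurable_funD.
Qed.

(** With Tonelli's theorem a rotation by 45 degrees reduces to two affine
    substitutions on the line, each with slope [sqrt 2]: first
    [x = sqrt 2 * u + y] at fixed [y], which turns the second coordinate into
    [sqrt 2 * y + u], then [v = sqrt 2 * y + u] at fixed [u]. *)
Lemma integral_rot45 (f : measurableTypeR R * measurableTypeR R -> \bar R) :
  measurable_fun setT f -> (forall z, 0 <= f z) ->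
  \int[mu \x mu]_z f (rot45 z) = \int[mu \x mu]_z f z.
Proof.
move=> mf f0.
pose r : R := Num.sqrt 2.
have r0 : (0 < r)%R by rewrite sqrtr_gt0.
have rr : (r * r = 2)%R by rewrite -expr2 sqr_sqrtr.
have rN0 := lt0r_neq0 r0.
have mrot := measurable_rot45.
pose g (z : measurableTypeR R * measurableTypeR R) := f (z.1, (r * z.2 + z.1)%R).
have mg : measurable_fun setT g.
  apply: measurableT_comp => //; apply: measurable_fun_pair => //.
  by apply: measurable_funD => //; apply: measurable_funM.
have g0 z : 0 <= g z by exact: f0.
rewrite fubini_tonelli2//; last exact: measurableT_comp.
transitivity (\int[mu]_y (r%:E * \int[mu]_u g (u, y))).
  apply: eq_integral => y _; rewrite /fubini_G.
  rewrite [LHS](integral_affine y r0)//.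
    congr (_ * _); apply: eq_integral => u _; congr f.
    rewrite /rot45/= -/r; congr pair; first by field.
    by apply: (mulIf rN0); rewrite divfK// mulrDl mulrAC rr; lra.
  by apply: (@measurable_fun_pair1 _ _ _ _ _ _ (f \o rot45)); exact: measurableT_comp.
rewrite ge0_integralZl ?lee_fin ?(ltW r0)//; last 2 first.
- exact: (measurable_fun_fubini_tonelli_G (m1 := mu) g mg g0).
- by move=> y _; exact: integral_ge0.
rewrite -(fubini_tonelli (m1 := mu) (m2 := mu) g mg g0)//.
rewrite -ge0_integralZl ?lee_fin ?(ltW r0)//; last 2 first.
- exact: (measurable_fun_fubini_tonelli_F (m2 := mu) g mg g0).
- by move=> y _; exact: integral_ge0.
rewrite fubini_tonelli1//; apply: eq_integral => u _; rewrite /fubini_F.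
rewrite [RHS](integral_affine u r0)//.
exact: measurable_fun_pair2.
Qed.

(** The joint density only depends on [x ^+ 2 + y ^+ 2]. *)
Lemma normal_pdf_rot45 (z : measurableTypeR R * measurableTypeR R) :
  (normal_pdf 0 1 (rot45 z).1 * normal_pdf 0 1 (rot45 z).2 =
   normal_pdf 0 1 (z.1 : R) * normal_pdf 0 1 (z.2 : R))%R.
Proof.
rewrite !normal_pdfE ?oner_neq0// /normal_fun.
rewrite mulrACA -expRD [RHS]mulrACA -[in RHS]expRD; congr (_ * expR _)%R.
rewrite /rot45/= !subr0 !expr_div_n sqr_sqrtr//.
by move: z => [x y] /=; field.
Qed.

Lemma std_normal2_rot45 S : measurable S ->
  (N \x N) [set z | S (rot45 z)] = (N \x N) S.
Proof.
move=> mS.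
have mrS : measurable [set z | S (rot45 z)].
  by rewrite -[X in measurable X]setTI; exact: measurable_rot45.
have mrot := measurable_rot45.
have m1S : measurable_fun setT (fun z => (\1_S z : R)%:E).
  exact/measurable_EFinP/measurable_indic.
have mpp : measurable_fun setT (fun z : measurableTypeR R * measurableTypeR R =>
    (normal_pdf 0 1 z.1 * normal_pdf 0 1 z.2)%:E).
  have mpdf : measurable_fun [set: measurableTypeR R] (normal_pdf (0 : R) 1).
    exact: measurable_normal_pdf.
  by apply/measurable_EFinP; apply: measurable_funM; exact: measurableT_comp.
transitivity (\int[N \x N]_z (\1_S (rot45 z))%:E).
  by have /esym := integral_indic (N \x N) measurableT mrS; rewrite setIT.
transitivity (\int[N \x N]_z (\1_S z)%:E); last first.
  by have := integral_indic (N \x N) measurableT mS; rewrite setIT.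
rewrite !integral_std_normal2//; last first.
  by apply: (measurableT_comp m1S).
rewrite -[RHS]integral_rot45; last 2 first.
- exact: emeasurable_funM.
- by move=> z; rewrite mule_ge0// lee_fin mulr_ge0// normal_pdf_ge0.
apply: eq_integral => z _.
by rewrite -(normal_pdf_rot45 z).
Qed.

End std_normal_law.

(** * Sums of standard complex normal variables *)

Section complex_normal_laws.
Local Open Scope ereal_scope.
Variable R : realType.
Local Notation N := (std_normal R).
Local Notation C := (std_complex_normal R).
Local Notation RT := (measurableTypeR R).

Lemma std_normal2_sub A : measurable A ->
  (N \x N) [set z : RT * RT | A ((z.1 - z.2) / Num.sqrt 2 : R)%R] = N A.
Proof.
move=> mA; rewrite -(product_measure_fst N N mA).
apply: (std_normal2_rot45 (S := [set z | A z.1])).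
by rewrite -[X in measurable X]setTI; exact: measurable_fst.
Qed.

Lemma std_normal2_add A : measurable A ->
  (N \x N) [set z : RT * RT | A ((z.1 + z.2) / Num.sqrt 2 : R)%R] = N A.
Proof.
move=> mA; rewrite -(product_measure_snd N N mA).
apply: (std_normal2_rot45 (S := [set z | A z.2])).
by rewrite -[X in measurable X]setTI; exact: measurable_snd.
Qed.

Lemma std_complexE (x y : R) : std_complex (x, y) =
  Complex (x / Num.sqrt 2)%R (y / Num.sqrt 2)%R.
Proof.
rewrite /std_complex -fmorphV /=.
by congr Complex; rewrite /= mulr0 (subr0, add0r).
Qed.

Lemma std_complex_normal_Re A : measurable A ->
  C [set g | A (Num.sqrt 2 * complex.Re g : R)%R] = N A.
Proof.
move=> mA; rewrite -(product_measure_fst N N mA).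
rewrite /std_complex_normal /distribution /pushforward.
congr ((N \x N) _); apply/funext => -[x y]; rewrite /preimage.
transitivity (A (Num.sqrt 2 * complex.Re (std_complex (x, y)))%R) => //.
rewrite std_complexE/=; congr (A _).
by rewrite mulrC divfK// lt0r_neq0// sqrtr_gt0.
Qed.

(** The law of [g + conj g'] for independent standard complex normal [g, g']:
    its real part only involves the real parts of [g] and [g'], its imaginary
    part only the imaginary parts, so interchanging the four real coordinates
    makes the two parts independent, and each is a coordinate of a rotated
    pair. *)
Lemma std_complex_normal_sum_conj A B : measurable A -> measurable B ->
  (C \x C) [set g | A (complex.Re g.1 + complex.Re g.2 : R)%R /\
                    B (complex.Im g.1 - complex.Im g.2 : R)%R] = N A * N B.
Proof.
move=> mA mB.
have mReD : measurable_fun setT (fun g : R[i] * R[i] =>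
    complex.Re g.1 + complex.Re g.2)%R.
  by apply: measurable_funD; apply: measurableT_comp => //; exact: measurable_Re.
have mImB : measurable_fun setT (fun g : R[i] * R[i] =>
    complex.Im g.1 - complex.Im g.2)%R.
  by apply: measurable_funB; apply: measurableT_comp => //; exact: measurable_Im.
have mAB : measurable
    ((fun g : R[i] * R[i] => complex.Re g.1 + complex.Re g.2)%R @^-1` A `&`
     (fun g : R[i] * R[i] => complex.Im g.1 - complex.Im g.2)%R @^-1` B).
  by apply: measurableI; rewrite -[X in measurable X]setTI;
    [exact: mReD|exact: mImB].
have mD : measurable_fun setT (fun z : RT * RT => (z.1 + z.2) / Num.sqrt 2 : R)%R.
  by apply: measurable_funM => //; exact: measurable_funD.
have mS : measurable_fun setT (fun z : RT * RT => (z.1 - z.2) / Num.sqrt 2 : R)%R.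
  by apply: measurable_funM => //; exact: measurable_funB.
have msc := @measurable_std_complex R.
pose N2 : probability (RT * RT)%type R := N \x N.
pose N4 : probability ((RT * RT) * (RT * RT))%type R := N2 \x N2.
rewrite -(@joint_law2 _ _ _ _ _ _ _ N4 C C (@std_complex R \o fst)
  (@std_complex R \o snd)); last 4 first.
- exact: measurableT_comp.
- exact: measurableT_comp.
- move=> U V mU mV.
  apply: (@product_measure1E _ _ _ _ _ N2 N2);
    rewrite -[X in measurable X]setTI; exact: msc.
- exact: mAB.
rewrite -(std_normal2_add mA) -(std_normal2_sub mB).
rewrite -product_measure_interchange.
- congr (N4 _); apply/funext => -[[x1 y1] [x2 y2]].
  transitivity (
    A (complex.Re (std_complex (x1, y1)) + complex.Re (std_complex (x2, y2)))%R /\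
    B (complex.Im (std_complex (x1, y1)) - complex.Im (std_complex (x2, y2)))%R).
    by [].
  by rewrite !std_complexE/= -mulrDl -mulrBl.
- by rewrite -[X in measurable X]setTI; exact: mD.
- by rewrite -[X in measurable X]setTI; exact: mS.
Qed.

End complex_normal_laws.

(** * Comparing the absolute values of three normal variables *)

Section comparison_sets.
Context d (T : measurableType d) (R : realType) (f g : T -> R).
Hypotheses (mf : measurable_fun setT f) (mg : measurable_fun setT g).

Lemma measurable_set_ltr : measurable [set t | f t < g t].
Proof.
have /(_ measurableT [set true] I) := measurable_fun_ltr mf mg.
by rewrite setTI.
Qed.

Lemma measurable_set_eqr : measurable [set t | f t = g t].
Proof.
have /(_ measurableT [set true] I) := measurable_fun_eqr mf mg.
rewrite setTI; congr measurable; apply/seteqP.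
by split => t /eqP.
Qed.

End comparison_sets.

Section magnitudes.
Local Open Scope ereal_scope.
Variable R : realType.
Local Notation N := (std_normal R).
Local Notation RT := (measurableTypeR R).

(** This is [|x| + |y| = max (|x - y|, |x + y|)], read in rotated
    coordinates. *)
Lemma addr_norm_rot45 (z : RT * RT) : (`|z.1 : R| + `|z.2 : R| =
  Num.sqrt 2 * Num.max `|(rot45 z).1 : R| `|(rot45 z).2 : R|)%R.
Proof.
have r0 : (0 < Num.sqrt 2 :> R)%R by rewrite sqrtr_gt0.
have rN0 := lt0r_neq0 r0.
rewrite /rot45 maxr_pMr ?(ltW r0)//= !normf_div (gtr0_norm r0).
rewrite ![(Num.sqrt 2 * _)%R]mulrC !divfK//.
case: z => x y /=.
have [x0|x0] := ger0P x; have [y0|y0] := ger0P y;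
have [xy|xy] := ger0P (x - y)%R; have [xy'|xy'] := ger0P (x + y)%R;
rewrite /Num.max; case: ifPn => h; lra.
Qed.

Lemma std_normal_set1 x : N [set x] = 0.
Proof.
have /null_content_dominatesP Nmu := @normal_prob_dominates R 0 1.
by apply: Nmu => //; exact: lebesgue_measure_set1.
Qed.

(** Each vertical section of this set has at most two points, and the normal
    law has no atoms. *)
Lemma std_normal2_eq_norm : (N \x N) [set z | `|z.1 : R|%R = `|z.2 : R|%R] = 0.
Proof.
apply: integral0_eq => x _ /=.
apply/eqP; rewrite eq_le measure_ge0 andbT.
have xS : xsection [set z : RT * RT | `|z.1 : R|%R = `|z.2 : R|%R] x `<=`
    [set x] `|` [set (- x)%R].
  move=> y; rewrite /xsection/= inE/= => /esym/eqP.
  by rewrite eqr_norm2 => /orP[] /eqP ->; [left|right].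
have N0 : N ([set x] `|` [set (- x)%R]) = 0.
  by apply: null_set_setU => //; exact: std_normal_set1.
rewrite -N0; apply: le_measure => //; rewrite inE.
- apply: measurable_xsection.
  apply: measurable_set_eqr => //;
  exact: measurableT_comp.
- exact: measurableU.
Qed.

Lemma measurable_pivot_region : measurable
  [set p : (RT * RT) * RT |
    (Num.sqrt 2 * `|p.2 : R| < `|p.1.1 : R| + `|p.1.2 : R|)%R].
Proof.
apply: measurable_set_ltr => //.
  by apply: measurable_funM => //; exact: measurableT_comp.
apply: measurable_funD; apply: measurableT_comp => //; exact: measurableT_comp.
Qed.

Lemma measurable_max_region : measurable
  [set p : (RT * RT) * RT | (`|p.2 : R| < Num.max `|p.1.1 : R| `|p.1.2 : R|)%R].
Proof.
apply: measurable_set_ltr => //.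
  exact: measurableT_comp.
apply: measurable_maxr; apply: measurableT_comp => //; exact: measurableT_comp.
Qed.

Lemma pivot_region_rot45 : ((N \x N) \x N)
    [set p | Num.sqrt 2 * `|p.2 : R| < `|p.1.1 : R| + `|p.1.2 : R|]%R =
  ((N \x N) \x N)
    [set p | `|p.2 : R| < Num.max `|p.1.1 : R| `|p.1.2 : R|]%R.
Proof.
pose N2 : probability (RT * RT)%type R := N \x N.
pose N3 : probability ((RT * RT) * RT)%type R := N2 \x N.
have mrot := @measurable_rot45 R.
rewrite -[RHS](@joint_law2 _ _ _ _ _ _ _ N3 N2 N
  (@rot45 R \o fst) snd); last 4 first.
- exact: measurableT_comp.
- exact: measurable_snd.
- move=> A B mA mB.
  transitivity (N2 (@rot45 R @^-1` A) * N B); last first.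
    by congr (_ * _); exact: std_normal2_rot45.
  apply: (@product_measure1E _ _ _ _ _ N2 N) => //.
  by rewrite -[X in measurable X]setTI; exact: mrot.
- exact: measurable_max_region.
congr (N3 _); apply/funext => p /=.
by rewrite addr_norm_rot45 ltr_pM2l// sqrtr_gt0.
Qed.

End magnitudes.

Section largest.
Context d (T : measurableType d) (R : realType) (P : probability T R).
Variable Z : 'I_3 -> {RV P >-> R}.
Hypothesis hZ : iid Z (std_normal R).
Local Notation N := (std_normal R).
Local Notation RT := (measurableTypeR R).

Lemma iid_normal_law3 (i j k : 'I_3) (S : set (RT * RT * RT)) :
  uniq [:: i; j; k] -> measurable S ->
  P [set t | S ((Z i t, Z j t), Z k t)] = ((N \x N) \x N)%E S.
Proof.
move=> ijk mS; apply: (iid_law3 (h := id : R -> RT) hZ _ _ ijk mS) => //.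
Qed.

(** Up to the null event of a tie, the sample space is the disjoint union of
    the three events that a given variable has the largest absolute value, and
    these have the same probability because the joint law of [(Z i, Z j, Z k)]
    does not depend on the order of the indices. *)
Lemma iid_normal_lt_max :
  P [set t | `|Z 2 t| < Num.max `|Z 0 t| `|Z 1 t|]%R = (2 / 3)%:E.
Proof.
(* [F i j k] is the event that variable [k] wins strictly. *)
pose F i j k := [set t | (`|Z i t| < `|Z k t|)%R /\ (`|Z j t| < `|Z k t|)%R].
pose tie i j := [set t | `|Z i t|%R = `|Z j t|%R].
pose ties := tie 0 1 `|` tie 0 2 `|` tie 1 2.
have mZ i : measurable_fun setT (fun t => `|Z i t|%R) by exact: measurableT_comp.
have mlt i j : measurable [set t | (`|Z i t| < `|Z j t|)%R].
  by exact: measurable_set_ltr.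
have mF i j k : measurable (F i j k).
  exact: (measurableI _ _ (mlt i k) (mlt j k)).
have mtie i j : measurable (tie i j).
  by exact: measurable_set_eqr.
have mties : measurable ties.
  by rewrite /ties; do ! [exact: mtie | apply: measurableU].
have tie0 i j k : uniq [:: i; j; k] -> P (tie i j) = 0%E.
  move=> ijk.
  pose S := [set z : RT * RT | `|z.1 : R|%R = `|z.2 : R|%R].
  have mS : measurable S.
    apply: measurable_set_eqr => //;
    exact: measurableT_comp.
  rewrite -[RHS](@std_normal2_eq_norm R) -(product_measure_fst _ N mS).
  rewrite -(iid_normal_law3 ijk)//.
  by rewrite -[X in measurable X]setTI; exact: measurable_fst.
have ties0 : P ties = 0%E.
  have t01 : P (tie 0 1) = 0%E by exact: (tie0 0 1 2).
  have t02 : P (tie 0 2) = 0%E by exact: (tie0 0 2 1).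
  have t12 : P (tie 1 2) = 0%E by exact: (tie0 1 2 0).
  by rewrite /ties; do 2 (apply: null_set_setU => //; try exact: measurableU).
pose q := P (F 0 1 2).
have Fq i j k : uniq [:: i; j; k] -> P (F i j k) = q.
  move=> ijk.
  pose S := [set p : (RT * RT) * RT | (`|p.1.1 : R| < `|p.2 : R|)%R /\
    (`|p.1.2 : R| < `|p.2 : R|)%R].
  have mS : measurable S.
    apply: measurableI; apply: measurable_set_ltr; apply: measurableT_comp => //;
    exact: measurableT_comp.
  transitivity (((N \x N) \x N)%E S); last apply: esym; exact: iid_normal_law3.
have asym (x y : R) : x < y -> y < x -> False.
  by move=> xy /(lt_trans xy); rewrite ltxx.
have trich t : [\/ F 0 1 2 t, F 0 2 1 t, F 1 2 0 t | ties t].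
  rewrite /F /ties /tie /=.
  have [a|a|a] := ltgtP `|Z 0 t| `|Z 1 t|; last by apply: Or44; left; left.
    have [b|b|b] := ltgtP `|Z 1 t| `|Z 2 t|; last by apply: Or44; right.
      by apply: Or41; split=> //; exact: lt_trans b.
    by apply: Or42.
  have [b|b|b] := ltgtP `|Z 0 t| `|Z 2 t|; last by apply: Or44; left; right.
    by apply: Or41; split=> //; exact: lt_trans b.
  by apply: Or43.
have F01 : P (F 0 2 1 `|` F 1 2 0) = (q + q)%E.
  rewrite measureU//; first by congr (_ + _)%E; exact: Fq.
  by apply/seteqP; split => // t [] [a _] [b _]; exact: (asym _ _ a b).
have mF01 : measurable (F 0 2 1 `|` F 1 2 0) by exact: measurableU.
have mF012 : measurable (F 0 2 1 `|` F 1 2 0 `|` F 0 1 2) by exact: measurableU.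
have q3 : (q + q + q = 1)%E.
  rewrite -F01 -measureU//; last first.
    by apply/seteqP; split => // t [] [] [a b] [c e];
    [exact: (asym _ _ b e)|exact: (asym _ _ b c)].
  apply: (etrans (esym (measureU0 mF012 mties ties0))).
  apply: etrans (probability_setT P).
  congr (P _); apply/seteqP; split => // t _.
  by case: (trich t); [left; right|left; left; left|left; left; right|right].
have q13 : q = (1 / 3)%:E.
  have qfin : q = (fine q)%:E by rewrite fineK// fin_num_measure.
  move: q3; rewrite qfin -!EFinD => -[q3]; congr EFin; lra.
have -> : (2 / 3)%:E = (q + q)%E by rewrite q13 -EFinD; congr EFin; lra.
have mM : measurable [set t | `|Z 2 t| < Num.max `|Z 0 t| `|Z 1 t|].
  by apply: measurable_set_ltr => //; exact: measurable_maxr.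
apply: (etrans (esym (measureU0 mM mties ties0))).
rewrite -F01; apply: etrans (measureU0 mF01 mties ties0).
congr (P _); apply/seteqP; split => t [] => [|?|[]|?]; try by right.
- move=> /=; rewrite lt_max => h.
  case: (trich t) => [[a b]|h'|h'|]; [|by left; left|by left; right|by right].
  by case/orP: h => /asym; [case/(_ a)|case/(_ b)].
- by move=> [a b]; left; rewrite /= lt_max b orbT.
- by move=> [a b]; left; rewrite /= lt_max b.
Qed.

End largest.

(** * The pivot of a Gaussian unitary matrix *)

Section GUE.
Context d (T : measurableType d) (R : realType) (P : probability T R).
Local Notation N := (std_normal R).
Local Notation C := (std_complex_normal R).
Local Notation RT := (measurableTypeR R).

Lemma GUE2_entries (A : T -> 'M[R[i]]_2) (G : 'I_2 * 'I_2 -> {RV P >-> R[i]}) t :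
  (let M := \matrix_(i < 2, j < 2) G (i, j) t in
   A t = (real_complex R (Num.sqrt 2))^-1 *: (M + conj_transpose M)) ->
  A t 0 0 = Complex (Num.sqrt 2 * complex.Re (G (0, 0) t)) 0 /\
  A t 1 0 = Complex
    ((complex.Re (G (1, 0) t) + complex.Re (G (0, 1) t)) / Num.sqrt 2)
    ((complex.Im (G (1, 0) t) - complex.Im (G (0, 1) t)) / Num.sqrt 2).
Proof.
move=> /= ->; rewrite /conj_transpose !mxE -fmorphV.
case: (G (0, 0) t) (G (1, 0) t) (G (0, 1) t) => [a b] [c d'] [e f] /=.
have r0 : 0 < Num.sqrt 2 :> R by rewrite sqrtr_gt0.
have rN0 := lt0r_neq0 r0.
split; congr Complex; rewrite /= ?mul0r ?mulr0 ?subr0 ?addr0 ?subrr ?mulr0//.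
- apply: (mulfI rN0); rewrite mulrA divff// mul1r mulrA -expr2 sqr_sqrtr//; lra.
- exact: mulrC.
- exact: mulrC.
Qed.

(** The three variables are [sqrt 2 Re A_21], [sqrt 2 Im A_21] and [A_11].  The
    last one is independent of the others because diagonal and off-diagonal
    entries of [A] use different entries of [G]. *)
Lemma measure_GUE2_pivot (G : 'I_2 * 'I_2 -> {RV P >-> R[i]})
    (S : set (RT * RT * RT)) :
  iid G C -> measurable S ->
  P [set t | S ((complex.Re (G (1, 0) t) + complex.Re (G (0, 1) t),
                 complex.Im (G (1, 0) t) - complex.Im (G (0, 1) t)),
                 Num.sqrt 2 * complex.Re (G (0, 0) t))] = ((N \x N) \x N)%E S.
Proof.
move=> iidG mS.
pose C2 : probability (R[i] * R[i])%type R := (C \x C)%E.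
pose C3 : probability ((R[i] * R[i]) * R[i])%type R := (C2 \x C)%E.
pose X (g : R[i] * R[i]) : RT := complex.Re g.1 + complex.Re g.2.
pose Y (g : R[i] * R[i]) : RT := complex.Im g.1 - complex.Im g.2.
pose V (g : R[i]) : RT := Num.sqrt 2 * complex.Re g.
have mX : measurable_fun setT X.
  by apply: measurable_funD; apply: measurableT_comp => //; exact: measurable_Re.
have mY : measurable_fun setT Y.
  by apply: measurable_funB; apply: measurableT_comp => //; exact: measurable_Im.
have mV : measurable_fun setT V.
  by apply: measurable_funM => //; exact: measurable_Re.
have mXf : measurable_fun setT (X \o @fst _ R[i]) by exact: measurableT_comp.
have mYf : measurable_fun setT (Y \o @fst _ R[i]) by exact: measurableT_comp.
have mVs : measurable_fun setT (V \o @snd (R[i] * R[i]) _).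
  by exact: measurableT_comp.
have mXYV : measurable_fun setT (fun w : R[i] * R[i] * R[i] =>
    ((X w.1, Y w.1), V w.2)).
  by do 2 apply: measurable_fun_pair => //.
rewrite -(@joint_law3 _ _ _ _ _ _ _ _ _ C3 N N N
  (X \o fst) (Y \o fst) (V \o snd))//; last first.
  move=> A B D mA mB mD.
  rewrite -(std_complex_normal_sum_conj mA mB) -(std_complex_normal_Re mD).
  apply: (@product_measure1E _ _ _ _ _ C2 C).
  - by apply: (measurableI (X @^-1` A) (Y @^-1` B));
      rewrite -[X in measurable X]setTI; [exact: mX|exact: mY].
  - by rewrite -[X in measurable X]setTI; exact: mV.
apply: (iid_law3 (h := id) (S := [set w | S ((X w.1, Y w.1), V w.2)]) iidG) => //.
by rewrite -[X in measurable X]setTI; exact: mXYV.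
Qed.

End GUE.

Theorem proposition1 (R : realType)
    (d : measure_display) (T : measurableType d) (P : probability T R)
    (A : T -> 'M[R[i]]_2) (hA : is_GUE2 P A)
    (d' : measure_display) (T' : measurableType d') (P' : probability T' R)
    (Z : 'I_3 -> {RV P' >-> R}) (hZ : iid Z (std_normal R)) :
  [/\ pivot_probability P (@l1norm R) A =
        P [set t | l1norm (A t 1 0) > Normc.normc (A t 0 0)],
      P [set t | l1norm (A t 1 0) > Normc.normc (A t 0 0)] =
        P' [set t | `|Z 0 t| + `|Z 1 t| > Num.sqrt 2 * `|Z 2 t|] &
      P' [set t | `|Z 0 t| + `|Z 1 t| > Num.sqrt 2 * `|Z 2 t|] =
        (2 / 3)%:E].
Proof.
have [G [iidG AG]] := hA.
have r0 : 0 < Num.sqrt 2 :> R by rewrite sqrtr_gt0.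
have lawZ : P' [set t | `|Z 0 t| + `|Z 1 t| > Num.sqrt 2 * `|Z 2 t|] = _ :=
  iid_normal_law3 hZ (i := 0) (j := 1) (k := 2) isT (@measurable_pivot_region R).
split.
- congr (P _); apply/funext => t /=; rewrite /row_swap.
  have [-> _] := GUE2_entries (AG t).
  by rewrite /l1norm/= normr0 addr0 expr0n/= addr0 sqrtr_sqr.
- rewrite lawZ -(measure_GUE2_pivot iidG (@measurable_pivot_region R)).
  congr (P _); apply/funext => t /=.
  have [-> ->] := GUE2_entries (AG t).
  rewrite /l1norm/= expr0n/= addr0 sqrtr_sqr.
  rewrite !normf_div (gtr0_norm r0) -mulrDl ltr_pdivlMr//.
  by rewrite [_ * Num.sqrt 2]mulrC.
- rewrite lawZ pivot_region_rot45 -(iid_normal_lt_max hZ).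
  by rewrite -(iid_normal_law3 hZ (i := 0) (j := 1) (k := 2) isT
    (@measurable_max_region R)).
Qed.
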